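(* Let $G$ be an $n$-vertex graph of diameter $D$ (a constant), let $\mathcal{S}$ be a collection of vertex-disjoint subsets of $V(G)$ each inducing a connected subgraph, and let $H_1,\ldots,H_N$ be the random subgraphs produced by the centralized shortcut construction described below for the large parts $S_1,\ldots,S_N$. Then for each $j\in\{1,\ldots,N\}$, with high probability the diameter of $H=G[S_j]\cup H_j$ is $O(k_D\log n)$.
   Context: Let $k_D=n^{(D-2)/(2D-2)}$ and $N=\lceil n/k_D\rceil$. A part $S_i\in\mathcal{S}$ is large if $|S_i|>k_D$; there are at most $N$ large parts, denoted $S_1,\ldots,S_N$. Let $\mathbf{p}=(k_D\log n)/N$. Centralized construction (for even $D$): for each $i\in\{1,\ldots,N\}$, (1) every vertex $v\in S_i$ adds all its incident edges to $H_i$; (2) every vertex $u\in V\setminus S_i$ adds each of its incident edges $(u,v)$ to $H_i$ independently with probability $\mathbf{p}$ (edges are sampled in a directed manner: $(u,v)$ is sampled by $u$ and $(v,u)$ by $v$); (3) step (2) is repeated $D$ times independently, and an edge is in $H_i$ if it is selected in at least one repetition. For odd $D$, the construction is modified as follows: each edge $e=(u,v)$ of $G$ is subdivided by a new vertex $x_e$ adjacent only to $u$ and $v$, giving a graph $G'$ of even diameter $2D$; the construction is run on $G'$ with sampling probability $\sqrt{\mathbf{p}}$ per edge of $G'$ (edges chosen in step (1) are taken, as the corresponding two-edge paths, with probability $1$), and $H_j$ consists of those edges $(u,v)$ of $G$ for which both $(u,x_e)$ and $(x_e,v)$ are selected. ''With high probability'' means with probability at least $1-1/n^{c}$ for any desired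 constant $c>1$.
   Formalization: The diameter of H is taken as the largest distance in H between two vertices of S_j, since H also contains sampled edges disconnected from S_j, which makes the literal diameter infinite; D is at least 2 (k_D is undefined for D = 1) and p is capped at 1. *)

(* Defs.v *)
From HB Require Import structures.
From mathcomp Require Import all_boot all_order all_algebra.
From mathcomp Require Import boolp classical_sets reals ereal exp.

Set Implicit Arguments.
Unset Strict Implicit.
Unset Printing Implicit Defensive.
Import Order.TTheory GRing.Theory Num.Theory.

Local Open Scope ring_scope.

(* A graph on a finite vertex type is given by its adjacency relation, which
   [theorem3p1] requires to be symmetric and irreflexive. *)

(* Infimum of the lengths of the walks from u to v; +oo when there is none. *)
Definition dist (R : realType) (V : finType) (e : rel V) (u v : V) : \bar R :=
  ereal_inf [set x | exists w : seq V,
    [/\ path e u w, last u w = v & x = (size w)%:R%:E]]%classic.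

(* Largest distance, measured in the whole graph e, between vertices of A.  For
   A = [set: V] this is the diameter of e.  The diameter of an augmented part
   G[S] with shortcut edges H is its dilation: A = S there, because H also has
   sampled edges far from S that are usually not connected to it. *)
Definition diam (R : realType) (V : finType) (e : rel V) (A : {set V}) : \bar R :=
  ereal_sup [set x | exists u v : V,
    [/\ u \in A, v \in A & x = dist R e u v]]%classic.

Definition induced (V : finType) (e : rel V) (A : {set V}) : rel V :=
  fun u v => [&& u \in A, v \in A & e u v].

Definition induces_connected (V : finType) (e : rel V) (A : {set V}) : Prop :=
  {in A &, forall u v, connect (induced e A) u v}.

Definition disjoint_connected_parts (V : finType) (e : rel V)
    (parts : {set {set V}}) : Prop :=
  finset.trivIset parts /\ {in parts, forall A, induces_connected e A}.

Definition kD (R : realType) (D n : nat) : R :=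
  n%:R `^ ((D%:R - 2) / (2 * D%:R - 2)).

Definition num_parts (R : realType) (D n : nat) : int :=
  Num.ceil (n%:R / kD R D n).

(* (k_D log n) / N can exceed 1 when n is small, hence the cap. *)
Definition pD (R : realType) (D n : nat) : R :=
  Num.min 1 (kD R D n * ln n%:R / (num_parts R D n)%:~R).

Definition large_parts (R : realType) (D : nat) (V : finType)
    (parts : {set {set V}}) : {set {set V}} :=
  [set A in parts | kD R D #|V| < #|A|%:R]%SET.

(* There are at most n / k_D large parts, so the indices used here are among
   those of the enumeration S_1, ..., S_N. *)
Definition large_part (R : realType) (D : nat) (V : finType)
    (parts : {set {set V}}) (j : 'I_#|large_parts R D parts|) : {set V} :=
  enum_val j.
Arguments large_part {R D V parts} j.

(* Probability of E when the coins indexed by I are independent, each being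
   true with probability q. *)
Definition coins_Pr (R : realType) (I : finType) (q : R)
    (E : set {ffun I -> bool}) : R :=
  \sum_(w : {ffun I -> bool} | `[< E w >])
    \prod_(i : I) (if w i then q else 1 - q).

(* The coin (j, r, (a, b)) decides whether a samples the arc (a, b) for the
   j-th subgraph in the r-th repetition.  Coins that do not correspond to an
   arc sampled by the construction are never consulted. *)
Definition coin (l m : nat) (W : finType) : finType := ('I_l * 'I_m * (W * W))%type.

Definition samples (l m : nat) (W : finType) (f : rel W) (A : {set W})
    (w : {ffun coin l m W -> bool}) (j : 'I_l) (a b : W) : bool :=
  [&& a \notin A, f a b & [exists r : 'I_m, w (j, r, (a, b))]].

(* Steps (1)-(3) on the graph f with the part A, as a set of undirected edges. *)
Definition centralized (l m : nat) (W : finType) (f : rel W) (A : {set W})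
    (w : {ffun coin l m W -> bool}) (j : 'I_l) : rel W :=
  fun a b => (f a b && ((a \in A) || (b \in A)))
          || (samples f A w j a b || samples f A w j b a).

Definition edges (V : finType) (e : rel V) : {set {set V}} :=
  [set [set p.1; p.2]%SET | p in [set p : V * V | e p.1 p.2]%SET]%SET.

Definition edge (V : finType) (e : rel V) : finType :=
  {x : {set V} | x \in edges e}.

(* The graph G': inl u is the vertex u of G, and inr x subdivides the edge x. *)
Definition subdivision (V : finType) (e : rel V) : rel (V + edge e) :=
  fun a b => match a, b with
  | inl u, inr x | inr x, inl u => u \in val x
  | _, _ => false
  end.

Definition centralized_odd (l m : nat) (V : finType) (e : rel V) (A : {set V})
    (w : {ffun coin l m (V + edge e)%type -> bool}) (j : 'I_l) : rel V :=
  fun u v =>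
    let H' := centralized (@subdivision V e) [set inl a | a in A]%SET w j in
    (e u v && ((u \in A) || (v \in A)))
    || [exists x : edge e, [&& e u v, val x == [set u; v]%SET,
                               H' (inl u) (inr x) & H' (inr x) (inl v)]].

(* Probability that the random family (H_j)_j of subgraphs, one for each large
   part, lies in E. *)
Definition shortcut_Pr (R : realType) (D : nat) (V : finType) (e : rel V)
    (parts : {set {set V}})
    (E : set ('I_#|large_parts R D parts| -> rel V)) : R :=
  let l := #|large_parts R D parts| in
  let p := pD R D #|V| in
  if odd D then
    coins_Pr (Num.sqrt p)
      (fun w : {ffun coin l D (V + edge e)%type -> bool} =>
         E (fun j => centralized_odd (large_part j) w j))
  else
    coins_Pr p
      (fun w : {ffun coin l D V -> bool} =>
         E (fun j => centralized e (large_part j) w j)).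

(* G[A] together with the edges of H. *)
Definition augmented (V : finType) (e : rel V) (A : {set V}) (H : rel V) : rel V :=
  fun u v => induced e A u v || H u v.

(* Main.v *)
(* Join s and t by a path u_0, ..., u_m inside the part S.  Fix a target b and
   let v_i(a) be the i-th vertex of a shortest path in G from u_a to b.  The edge
   v_0 v_1 touches S and is always present; a position a is i-open when the next
   i edges of its route were sampled, the i-th one in a repetition reserved for
   level i.  From any position one reaches the next i-open position in L_i steps:
   two i-open positions whose routes are at the same vertex are close to each
   other, so at most one edge trial per vertex is needed, and these trials use
   coins independent of the lower levels.  About (log n)/p distinct vertices
   suffice with high probability, whence L_{i+1} is about L_i (log n)/p, that is,
   L_i n^{1/(D-1)}.

   A route climbs to the middle of a D-step path, at cost k_D.  Climbing from s
   towards each b gives a middle vertex z_b at distance at most D/2 from b, and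
   climbing from t along the routes b -> z_b, with fresh repetitions, reaches one
   of these z_b.  For odd D the middle edge is shared: each side only needs its
   own half of the subdivided edge, which costs (log n)/sqrt p. *)

Require Import Defs.
From HB Require Import structures.
From mathcomp Require Import all_boot all_order all_algebra.
From mathcomp Require Import boolp classical_sets reals ereal sequences exp.
From mathcomp Require Import lra zify.
Import Order.TTheory GRing.Theory Num.Theory.
Local Open Scope ring_scope.

Set Implicit Arguments.
Unset Strict Implicit.
Unset Printing Implicit Defensive.

(** * Independent biased coins: expectation, conditioning and union bounds *)

Section Coins.
Variables (R : realType) (I : finType) (q : R).
Hypothesis q01 : 0 <= q <= 1.
Implicit Types (w : {ffun I -> bool}) (E F : set {ffun I -> bool}).

Definition weight w : R := \prod_i (if w i then q else 1 - q).

Definition expect (f : {ffun I -> bool} -> R) : R := \sum_w weight w * f w.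

Lemma weight_ge0 w : 0 <= weight w.
Proof. by case/andP: q01 => *; apply: prodr_ge0 => i _; case: ifP => _; lra. Qed.

Lemma coins_PrE E : coins_Pr q E = expect (fun w => `[< E w >]%:R).
Proof.
rewrite /coins_Pr big_mkcond; apply: eq_bigr => w _ /=.
by case: ifP => _; rewrite ?mulr1 ?mulr0.
Qed.

Lemma expect_le f g : (forall w, f w <= g w) -> expect f <= expect g.
Proof. by move=> fg; apply: ler_sum => w _; rewrite ler_wpM2l ?weight_ge0. Qed.

Lemma expectZ a f : expect (fun w => a * f w) = a * expect f.
Proof. by rewrite /expect mulr_sumr; apply: eq_bigr => w _; rewrite mulrCA. Qed.

(** The indicator is a product with one factor per coin, so the sum over all outcomes factorises. *)
Lemma expect_all_true (A : {set I}) :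
  expect (fun w => [forall c in A, w c]%:R) = q ^+ #|A|.
Proof.
transitivity (\sum_(w : {ffun I -> bool}) \prod_i
    ((if w i then q else 1 - q) * (if i \in A then (w i)%:R else 1))).
  apply: eq_bigr => w _; rewrite big_split /=; congr (_ * _).
  case: forallP => [wA|wA].
    rewrite big1 // => i _; case: ifP => // iA.
    by have /implyP := wA i; rewrite iA => ->.
  move/forallP: wA; rewrite negb_forall => /existsP[i].
  rewrite negb_imply => /andP[iA /negbTE wi].
  by rewrite (bigD1 i) //= iA wi mul0r.
rewrite -(bigA_distr_bigA
  (fun i (b : bool) => (if b then q else 1 - q) * (if i \in A then b%:R else 1))).
rewrite (eq_bigr (fun i => if i \in A then q else 1)) => [|i _].
  by rewrite -big_mkcond prodr_const.
by rewrite big_bool /=; case: (i \in A); rewrite ?(mulr1, mulr0, addr0) // addrC subrK.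
Qed.

(** The empty set in [expect_all_true] shows that the weights sum to 1. *)
Lemma expect1 a : expect (fun=> a) = a.
Proof.
have := expect_all_true finset.set0; rewrite cards0 expr0 => e1.
rewrite -[RHS]mulr1 -e1 -expectZ; apply: eq_bigr => w _.
congr (_ * _); case: forallP => [_|[]]; first by rewrite mulr1.
by move=> c; rewrite finset.in_set0.
Qed.

Definition resample (B : {set I}) w1 w2 : {ffun I -> bool} :=
  [ffun i => if i \in B then w2 i else w1 i].

(* Exchanging the coins of B between two independent samples preserves their
   joint law. *)
Lemma expect_resample (B : {set I}) f :
  expect f = expect (fun w1 => expect (fun w2 => f (resample B w1 w2))).
Proof.
pose sw (p : {ffun I -> bool} * {ffun I -> bool}) :=
  (resample B p.1 p.2, resample B p.2 p.1).
have swK : involutive sw.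
  case=> w1 w2; rewrite /sw /=.
  apply/eqP; rewrite xpair_eqE; apply/andP; split; apply/eqP/ffunP=> i;
    by rewrite !ffunE; case: (i \in B).
symmetry; transitivity
  (\sum_p weight p.1 * weight p.2 * f (resample B p.1 p.2)).
  rewrite -(pair_bigA _
    (fun w1 w2 => weight w1 * weight w2 * f (resample B w1 w2))) /=.
  apply: eq_bigr => w1 _; rewrite mulr_sumr; apply: eq_bigr => w2 _.
  by rewrite mulrA.
rewrite (reindex_inj (inv_inj swK)) /=.
transitivity (\sum_p weight p.1 * f p.1 * weight p.2).
  apply: eq_bigr => -[w1 w2] _ /=.
  have -> : resample B (resample B w1 w2) (resample B w2 w1) = w1.
    by apply/ffunP=> i; rewrite !ffunE; case: (i \in B).
  have -> : weight (resample B w1 w2) * weight (resample B w2 w1)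
      = weight w1 * weight w2.
    rewrite /weight -!big_split; apply: eq_bigr => i _ /=.
    by rewrite !ffunE; case: (i \in B) => //; rewrite mulrC.
  by rewrite mulrAC.
rewrite -(pair_bigA _ (fun w1 w2 => weight w1 * f w1 * weight w2)) /=.
apply: eq_bigr => w1 _; rewrite -mulr_sumr.
have := expect1 1; rewrite /expect (eq_bigr weight) => [->|w _].
  by rewrite mulr1.
by rewrite mulr1.
Qed.

(** Conditioning: the coins outside [B] may be frozen if the bound is uniform in their values. *)
Lemma coins_Pr_resample_le (B : {set I}) E eps :
  (forall w1, coins_Pr q (fun w2 => E (resample B w1 w2)) <= eps) ->
  coins_Pr q E <= eps.
Proof.
move=> Eeps; rewrite coins_PrE (expect_resample B) -[leRHS]expect1.
by apply: expect_le => w1; have := Eeps w1; rewrite coins_PrE.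
Qed.

Lemma coins_Pr_mono E F :
  (forall w, E w -> F w) -> coins_Pr q E <= coins_Pr q F.
Proof.
move=> EF; rewrite !coins_PrE; apply: expect_le => w.
rewrite ler_nat; case: asboolP => // /EF Fw.
by case: asboolP.
Qed.

Lemma coins_Pr_exists_le (T : finType) (E : T -> set {ffun I -> bool}) eps :
  (forall x, coins_Pr q (E x) <= eps) ->
  coins_Pr q (fun w => exists x, E x w) <= #|T|%:R * eps.
Proof.
move=> Eeps; apply: (@le_trans _ _ (\sum_x coins_Pr q (E x))).
  under eq_bigr => x _ do rewrite coins_PrE.
  rewrite coins_PrE /expect exchange_big; apply: ler_sum => w _.
  rewrite -mulr_sumr ler_wpM2l ?weight_ge0 //.
  case: asboolP => [[x Ex]|_]; last by rewrite sumr_ge0.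
  rewrite (bigD1 x) //=; case: asboolP => // _.
  by rewrite lerDl sumr_ge0.
apply: le_trans (_ : \sum_(x : T) eps <= _); first exact: ler_sum.
by rewrite sumr_const mulr_natl.
Qed.

Lemma coins_Pr_or_le E F a b :
  coins_Pr q E <= a -> coins_Pr q F <= b ->
  coins_Pr q (fun w => E w \/ F w) <= a + b.
Proof.
move=> Ea Fb; apply: le_trans (lerD Ea Fb).
rewrite !coins_PrE /expect -big_split; apply: ler_sum => w _ /=.
rewrite -mulrDr ler_wpM2l ?weight_ge0 // -natrD ler_nat.
case: asboolP => //; case: asboolP => //= nE; case: asboolP => //= nF.
by case.
Qed.

Lemma coins_Pr_compl_ge E F :
  (forall w, ~ E w -> F w) -> 1 - coins_Pr q E <= coins_Pr q F.
Proof.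
move=> EF; rewrite lerBlDr !coins_PrE /expect -big_split.
rewrite -[leLHS]expect1; apply: ler_sum => w _ /=.
rewrite -mulrDr ler_wpM2l ?weight_ge0 // -natrD ler1n.
case: asboolP => //; case: asboolP => // nE nF.
by case: nF; apply: EF.
Qed.

(** Induction on [T]: distinct labels give disjoint coin sets, so redrawing the coins of one trial
    leaves the others unchanged, and that trial contributes a factor of at most [1 - th]. *)
Lemma coins_Pr_disjoint_fail_le (X Y : eqType) (tau : X -> Y)
    (K : X -> {set I}) (T : seq X) th :
  uniq (map tau T) -> (forall x y, tau x != tau y -> [disjoint K x & K y]) ->
  {in T, forall x, th <= q ^+ #|K x|} -> th <= 1 ->
  coins_Pr q (fun w => {in T, forall x, ~~ [forall c in K x, w c]})
    <= (1 - th) ^+ size T.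
Proof.
move=> + + + th1; elim: T => [|x T IH] /=.
  move=> _ _ _; rewrite expr0 coins_PrE -[leRHS]expect1.
  by apply: expect_le => w; rewrite lern1 leq_b1.
case/andP=> xT uT dK thK.
have tl y : y \in T -> y \in x :: T by move=> yT; rewrite in_cons yT orbT.
rewrite coins_PrE (expect_resample (K x)).
have {IH} := IH uT dK (fun y yT => thK y (tl _ yT)).
set E := (E in coins_Pr q E) => IH.
apply: le_trans (_ : expect (fun w1 => (1 - th) * `[< E w1 >]%:R) <= _); last first.
  by rewrite expectZ exprS -coins_PrE ler_wpM2l // subr_ge0.
apply: expect_le => w1; rewrite mulrC.
apply: le_trans (_ : `[< E w1 >]%:R *
    expect (fun w2 => 1 - [forall c in K x, w2 c]%:R) <= _); last first.
  rewrite ler_wpM2l //; have -> : expect (fun w2 => 1 - [forall c in K x, w2 c]%:R)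
      = expect (fun=> 1) - expect (fun w2 => [forall c in K x, w2 c]%:R).
    by rewrite /expect -sumrB; apply: eq_bigr => w _; rewrite mulrBr.
  by rewrite expect1 expect_all_true lerD2l lerN2 thK ?mem_head.
rewrite -expectZ; apply: expect_le => w2.
case: asboolP => [allF|_]; last first.
  by rewrite mulr_ge0 // subr_ge0 lern1 leq_b1.
(* The other trials do not consult [K x], so their failure already shows in [w1]. *)
have -> : `[< E w1 >].
  apply/asboolP => y yT; have := allF y (tl _ yT).
  apply: contra => /forall_inP ally; apply/forall_inP => c cy.
  rewrite ffunE ifN ?ally //.
  have xy : tau x != tau y by apply: contraNneq xT => ->; exact: map_f.
  by have := dK x y xy; rewrite disjoint_sym => /disjointFr/(_ cy) ->.
have /negPf : ~~ [forall c in K x, w2 c].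
  apply: contra (allF x (mem_head _ _)) => /forall_inP allx.
  by apply/forall_inP => c cx; rewrite ffunE cx allx.
by move=> ->; rewrite subr0 mulr1.
Qed.

End Coins.

(** * Walks of bounded length *)

Section Walks.
Variable (V : finType).
Implicit Types (H : rel V) (x y z : V).

Definition near H (k : nat) x y : Prop :=
  exists p, [/\ path H x p, last x p = y & (size p <= k)%N].

Lemma near_refl H x : near H 0 x x.
Proof. by exists [::]. Qed.

Lemma near_edge H x y : H x y -> near H 1 x y.
Proof. by move=> xy; exists [:: y]; rewrite /= xy. Qed.

Lemma near_le H k l x y : (k <= l)%N -> near H k x y -> near H l x y.
Proof. by move=> kl [p [? ? pk]]; exists p; split => //; exact: leq_trans kl. Qed.

Lemma near_trans H k l x y z : near H k x y -> near H l y z -> near H (k + l) x z.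
Proof.
move=> [p [xp py pk]] [r [yr rz rl]]; exists (p ++ r).
by rewrite cat_path last_cat size_cat py xp; split=> //; exact: leq_add.
Qed.

Lemma near_sym H k x y : symmetric H -> near H k x y -> near H k y x.
Proof.
move=> Hsym [p [xp <- pk]]; exists (rev (belast x p)); split.
- by rewrite rev_path (eq_path (e' := H)) // => a b; rewrite Hsym.
- by case: p {xp pk} => //= a p; rewrite rev_cons last_rcons.
- by rewrite size_rev size_belast.
Qed.

(** Idle steps are allowed because a route that has reached its target stays there. *)
Lemma near_relay H k (v : nat -> V) :
  (forall i, (i < k)%N -> v i = v i.+1 \/ H (v i) (v i.+1)) -> near H k (v 0) (v k).
Proof.
elim: k => [|k IH] Hv; first exact: near_refl.
rewrite -addn1; apply: near_trans (IH _) _ => [i ik|]; first exact/Hv/ltnW.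
by rewrite addn1; case: (Hv k) => // [->|/near_edge //]; apply: near_le (near_refl _ _).
Qed.

End Walks.

(** * Next open positions and the walks leading to them *)

(** For [j <= m] the default is [m]: the end of the path serves as a goal when no open position is
    left. *)
Definition first_from (o : pred nat) (m j : nat) : nat :=
  (j + find o (iota j (m - j)))%N.

Section FirstFrom.
Variables (o : pred nat) (m : nat).

Lemma first_from_ge j : (j <= first_from o m j)%N.
Proof. exact: leq_addr. Qed.

Lemma first_from_le j : (j <= m)%N -> (first_from o m j <= m)%N.
Proof.
move=> jm; rewrite /first_from -leq_subRL //.
by rewrite (leq_trans (find_size _ _)) ?size_iota.
Qed.

Lemma first_fromP j : (first_from o m j < m)%N -> o (first_from o m j).
Proof.
rewrite /first_from => fm; set k := find _ _ in fm *.
have km : (k < m - j)%N by lia.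
by have := @nth_find _ 0%N o (iota j (m - j)); rewrite has_find size_iota nth_iota // => ->.
Qed.

Lemma before_first_from j a : (j <= a < first_from o m j)%N -> ~~ o a.
Proof.
rewrite /first_from => /andP[ja af].
have kf : (a - j < find o (iota j (m - j)))%N by lia.
have := before_find 0%N kf; rewrite nth_iota ?subnKC // => [->//|].
by rewrite -[leqRHS](size_iota j) (leq_trans kf) ?find_size.
Qed.

Lemma first_from_min j a : (j <= a)%N -> o a -> (first_from o m j <= a)%N.
Proof.
move=> ja oa; rewrite leqNgt; apply/negP => af.
by have := @before_first_from j a; rewrite ja af oa => /(_ isT).
Qed.

Lemma first_from_mid j a : (j <= a <= first_from o m j)%N ->
  (j <= m)%N -> first_from o m a = first_from o m j.
Proof.
move=> /andP[ja af] jm; have fm := first_from_le jm.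
apply/eqP; rewrite eqn_leq; apply/andP; split.
  have [fm'|] := ltnP (first_from o m j) m.
    by rewrite first_from_min ?first_fromP.
  by move=> mf; rewrite (leq_trans (first_from_le (leq_trans af fm))).
rewrite leqNgt; apply/negP => lt.
have := @before_first_from j (first_from o m a).
rewrite lt (leq_trans ja (first_from_ge _)) first_fromP => [/(_ isT)//|].
exact: leq_trans lt fm.
Qed.

End FirstFrom.

(* Walk to the next o-position; if it is not the goal, jump to the last
   o-position before the goal with the same label and step past it: each round
   uses up one label. *)
Lemma near_first_from_step (V : finType) (X : eqType) (H : rel V) (u : nat -> V)
    (m : nat) (o o' : pred nat) (tau : nat -> X) (l c N j : nat) :
  (forall a, o' a -> o a) ->
  (forall a, (a < m)%N -> near H 1 (u a) (u a.+1)) ->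
  (forall a b, o a -> o b -> tau a = tau b -> near H c (u a) (u b)) ->
  (forall a, (a <= m)%N -> near H l (u a) (u (first_from o m a))) ->
  (j <= m)%N ->
  (forall ts : seq nat, uniq (map tau ts) ->
     {in ts, forall a, (j <= a < first_from o' m j)%N && o a} -> (size ts <= N)%N) ->
  near H (N * (l + c + 1) + l) (u j) (u (first_from o' m j)).
Proof.
move=> o'o step link base; elim: N j => [|N IH] j jm few.
all: have goalm := @first_from_le o' m j jm.
all: have := base j jm; have := first_from_ge o m j; have := @first_fromP o m j.
all: have := @first_from_le o m j jm.
all: have : (first_from o m j <= first_from o' m j)%N
  by (have [lt|ge] := ltnP (first_from o' m j) m;
    [rewrite first_from_min ?first_from_ge ?o'o ?first_fromP
    |rewrite (leq_trans (first_from_le _ jm))]).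
all: set a := first_from o m j; set g := first_from o' m j in goalm few *.
all: rewrite leq_eqVlt => /predU1P[<- _ _ _ na|ag am oa ja na].
- exact: near_le na.
(* No label may be used any more, so an [o]-position strictly before the goal is impossible. *)
- suff : (size [:: a] <= 0)%N by [].
  apply: few => // b; rewrite mem_seq1 => /eqP ->.
  by rewrite ja ag oa ?(leq_trans ag).
- exact: near_le (leq_addl _ _) na.
have {}oa : o a by rewrite oa ?(leq_trans ag).
pose P b := [&& (a <= b < g)%N, o b & tau b == tau a].
have exP : exists b, P b by exists a; rewrite /P leqnn ag oa eqxx.
have ubP b : P b -> (b <= g)%N by case/and3P => /andP[_ /ltnW].
have [b /and3P[/andP[ab bg] ob /eqP tb] bmax] := ex_maxnP exP ubP.
have Eg : first_from o' m b.+1 = g.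
  by apply: first_from_mid => //; rewrite -/g bg ltnW // ltnS (leq_trans ja).
have bm : (b < m)%N := leq_trans bg goalm.
have nb : near H (N * (l + c + 1) + l) (u b.+1) (u g).
  rewrite -Eg; apply: IH => // ts uts; rewrite Eg => its.
  (* Since [b] is maximal, the label of [a] does not recur after [b]. Adding [a] to [ts] keeps the
     labels distinct, which pays for the drop from [N.+1] to [N]. *)
  rewrite -ltnS; apply: (few (a :: ts)) => [/=|x]; rewrite ?uts ?andbT.
    apply/mapP => -[x xts ax]; have /andP[/andP[bx xg] ox] := its x xts.
    have /bmax : P x by rewrite /P xg ox ax eqxx (leq_trans ab (ltnW bx)).
    by rewrite leqNgt bx.
  rewrite inE => /predU1P[->|xts]; first by rewrite ja ag oa.
  have /andP[/andP[bx xg] ->] := its x xts.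
  by rewrite xg (leq_trans ja (leq_trans ab (ltnW bx))).
apply: near_le (near_trans na (near_trans (link a b oa ob (esym tb))
  (near_trans (step b bm) nb))); lia.
Qed.

(** * Levels of trials, and the probability that a level stalls *)

Section Phase.
Variables (R : realType) (I : finType) (X : eqType).
Variables (tau : nat -> nat -> X) (K : nat -> nat -> {set I}).
Implicit Types (w : {ffun I -> bool}) (i a : nat).

Definition success i a w := [forall c in K i a, w c].

Definition opened i a w := all (fun r => success r a w) (iota 0 i).

Lemma openedP i a w :
  reflect (forall r, (r < i)%N -> success r a w) (opened i a w).
Proof.
apply: (iffP allP) => [op r ri|op r].
  by apply: op; rewrite mem_iota.
by rewrite mem_iota => /op.
Qed.

Lemma openedS i a w : opened i.+1 a w = opened i a w && success i a w.
Proof. by rewrite /opened -[i.+1]addn1 iotaD all_cat /= andbT. Qed.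

Lemma success_resample_in (B : {set I}) i a w1 w2 : K i a \subset B ->
  success i a (resample B w1 w2) = success i a w2.
Proof.
move=> KB; apply: eq_forallb => c; case: (boolP (c \in K i a)) => //= cK.
by rewrite ffunE (fintype.subsetP KB).
Qed.

Lemma success_resample_out (B : {set I}) i a w1 w2 : [disjoint K i a & B] ->
  success i a (resample B w1 w2) = success i a w1.
Proof.
move=> KB; apply: eq_forallb => c; case: (boolP (c \in K i a)) => //= cK.
by rewrite ffunE (disjointFr KB).
Qed.

(** The window from [j] to [k] is a parameter because the position where a walk stops is random; the
    union bound runs over all windows. *)
Definition clogged (M : nat -> nat) i j k w : Prop :=
  (exists ts : seq nat, [/\ uniq (map (tau i) ts), (M i <= size ts)%N &
     {in ts, forall a, (j <= a < k)%N && opened i a w}]) /\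
  forall a, (j <= a < k)%N -> opened i a w -> ~~ success i a w.

Lemma clogged_Pr_le (q eps : R) (rk : I -> nat) (th : nat -> R) M h n :
  0 <= q <= 1 ->
  (forall i a c, (i < h)%N -> c \in K i a -> rk c = i) ->
  (forall i a b, (i < h)%N -> tau i a != tau i b -> [disjoint K i a & K i b]) ->
  (forall i, (i < h)%N -> 0 <= th i <= 1) ->
  (forall i a, (i < h)%N -> th i <= q ^+ #|K i a|) ->
  0 <= eps ->
  (forall i, (i < h)%N -> (1 - th i) ^+ M i <= eps) ->
  coins_Pr q (fun w => exists x : 'I_h * 'I_n * 'I_n,
      clogged M x.1.1 x.1.2 x.2 w) <= (h * n * n)%:R * eps.
Proof.
move=> q01 Krk Kdis th01 thK eps0 Meps.
have -> : (h * n * n)%N = #|{: 'I_h * 'I_n * 'I_n}| by rewrite !card_prod !card_ord.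
apply: coins_Pr_exists_le => // -[[[i ih] j] k] /=.
(* Only the coins of level [i] are redrawn; [opened i] consults ranks below [i]. *)
pose B := [set c | rk c == i]%SET.
have opB a w1 w2 : opened i a (resample B w1 w2) = opened i a w1.
  apply: eq_in_all => r; rewrite mem_iota => /andP[_ ri].
  rewrite success_resample_out //; apply/pred0P => c /=.
  apply/negP => /andP[cK]; rewrite finset.inE (Krk r a c) ?(ltn_trans ri) //.
  by rewrite ltn_eqF.
have sB a w1 w2 : success i a (resample B w1 w2) = success i a w2.
  by rewrite success_resample_in //; apply/fintype.subsetP => c /(Krk _ _ _ ih) Kc;
    rewrite finset.inE Kc.
apply: (coins_Pr_resample_le q01 (B := B)) => w1.
have [[ts [uts Mts its]]|nts] := pselect (exists ts : seq nat,
  [/\ uniq (map (tau i) ts), (M i <= size ts)%N &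
     {in ts, forall a, (j <= a < k)%N && opened i a w1}]); last first.
  apply: le_trans (_ : coins_Pr q (fun=> False) <= _).
    apply: coins_Pr_mono => // w2 [[ts [uts Mts its]] _]; apply: nts.
    by exists ts; split => // a /its; rewrite opB.
  by rewrite coins_PrE asboolF // expect1.
apply: le_trans (_ : (1 - th i) ^+ size ts <= _); last first.
  apply: le_trans (Meps i ih); have := th01 i ih => /andP[? ?].
  by rewrite ler_wiXn2l ?subr_ge0 // gerBl.
apply: le_trans (coins_Pr_disjoint_fail_le (K := K i) q01 uts _ _ _).
- apply: coins_Pr_mono => // w2 [_ fail] a /its /andP[ajk oa].
  by have := fail a ajk; rewrite opB sB => /(_ oa).
- by move=> a b; apply: Kdis.
- by move=> a _; apply: thK.
- by have /andP[] := th01 i ih.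
Qed.

End Phase.

(** * Walk lengths and failure rates *)

(** The recurrence of [near_first_from_step]: two positions with the same label at level [i'] are
    linked by two climbs of [i'.+1] edges. *)
Fixpoint cost (M : nat -> nat) (i : nat) : nat :=
  if i is i'.+1 then (M i' * (cost M i' + i'.+1.*2 + 1) + cost M i')%N else 0%N.

Lemma cost_le (M : nat -> nat) (h a b : nat) : (0 < h)%N ->
  (forall i, (i.+1 < h)%N -> M i = a) -> M h.-1 = b ->
  ((cost M h).*2 + h.*2.+1 <= 6 * ((a + 2) ^ h.-1 * (b + 2)))%N.
Proof.
(* The shift turns the recurrence into a purely multiplicative one. *)
case: h => // h _ Ma Mb; pose Z i := (cost M i + i.*2 + 3)%N.
have ZS i : (Z i.+1 <= Z i * (M i + 2))%N by rewrite /Z /=; nia.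
have Zh : (Z h <= 3 * (a + 2) ^ h)%N.
  have : (h <= h)%N by []; move: {-2}h => i; elim: i => // i IH ih.
  rewrite expnSr mulnA (leq_trans (ZS i)) // (Ma i) //.
  by rewrite leq_mul2r IH ?orbT // ltnW.
have Zh1 : (Z h.+1 <= 3 * (a + 2) ^ h * (b + 2))%N.
  by rewrite (leq_trans (ZS h)) // -[h]/(h.+1.-1) Mb leq_mul2r Zh orbT.
by move: Zh1; rewrite /Z /= -[(6)%N]/(2 * 3)%N -mulnA !mulnA; lia.
Qed.

(** This rests on [1 - th <= expR (- th)]. *)
Lemma fail_pow_le (R : realType) (n : nat) (c th : R) (M : nat) :
  (0 < n)%N -> 0 < th <= 1 -> c * ln n%:R / th <= M%:R ->
  (1 - th) ^+ M <= n%:R `^ (- c).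
Proof.
move=> n0 /andP[th0 th1]; rewrite ler_pdivrMr // => cM.
apply: (@le_trans _ _ (expR (- th) ^+ M)).
  by rewrite lerXn2r ?nnegrE ?subr_ge0 ?expR_ge0 // expR_ge1Dx.
rewrite -expRM_natl /powR pnatr_eq0 gtn_eqF // ler_expR.
by rewrite mulrN mulNr lerN2.
Qed.

(** * Numerical estimates for [kD], the number of parts and the sampling probability *)

Section Rates.
Variables (R : realType) (D n : nat).
Hypothesis D_gt1 : (1 < D)%N.
Hypothesis n_gtD : (D < n)%N.
Let N : R := n%:R.
Let t : R := ln N.
Let k : R := kD R D n.

(** The growth of the walk length per level, up to a constant: by [ln_le_pD], (log n)/p is at most D
    + 1 times this. *)
Definition branching : R := N `^ (D%:R - 1)^-1.
Let y := branching.

Let N_ge1 : 1 <= N. Proof. by rewrite ler1n (leq_trans _ n_gtD). Qed.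

Let N_neq0 : N != 0. Proof. by rewrite gt_eqF // (lt_le_trans ltr01). Qed.

Let D_gt0 : 0 < D%:R - 1 :> R. Proof. by rewrite subr_gt0 ltr1n. Qed.

Let i : R := (D%:R - 1)^-1.

Let Di : (D%:R - 1) * i = 1. Proof. by rewrite mulfV // gt_eqF. Qed.

Lemma kD_powRE : k = N `^ (2^-1 - i / 2).
Proof.
rewrite /k /kD; congr (_ `^ _).
have -> : 2 * D%:R - 2 = (D%:R - 1) * 2 :> R by lra.
by rewrite invfM -/i; have := Di; nra.
Qed.

Lemma branching_ge1 : 1 <= y.
Proof. by rewrite -[leLHS](powRr0 N) ler_powR // invr_ge0 ltW. Qed.

Lemma kD_ge1 : 1 <= k.
Proof.
rewrite kD_powRE -[leLHS](powRr0 N) ler_powR // subr_ge0 ler_pdivrMr //.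
by rewrite mulVf // invf_le1 // lerBrDr -[1 + 1]/(2%:R) ler_nat.
Qed.

(** The exponents 1 - 1/(D-1) and 1/(D-1) add up to 1. Hence n / k equals k y, which is how the
    number of parts is estimated. *)
Lemma kD_sqr_branching : k * k * y = N.
Proof.
rewrite kD_powRE -!powRD ?N_neq0 ?implybT //.
by rewrite (_ : _ + _ = 1) ?powRr1 ?(le_trans ler01) // -/i; lra.
Qed.

Lemma ln_ge_half : 2^-1 <= t.
Proof.
have N2 : 2 <= N by rewrite ler_nat (leq_trans (leqW D_gt1) n_gtD).
have N0 : 0 < N by lra.
have := @le_ln1Dx R (N^-1 - 1); rewrite addrCA subrr addr0 lnV ?posrE // -/t.
have iN : N^-1 <= 2^-1 by rewrite lef_pV2 ?posrE.
have : 0 < N^-1 by rewrite invr_gt0.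
by move=> iN0 ln_iN; have /ln_iN : -1 < N^-1 - 1; lra.
Qed.

(** Here ln n = (D - 1) ln y and ln y <= y. This serves the case where the sampling probability is
    capped at 1. *)
Lemma ln_le_branching : t <= (D%:R - 1) * y.
Proof.
have y0 : 0 < y := lt_le_trans ltr01 branching_ge1.
have : ln y <= y.
  have := @le_ln1Dx R (y - 1); rewrite addrCA subrr addr0 => ln_y.
  by have /ln_y : -1 < y - 1; lra.
rewrite {1}/y /branching ln_powR -/i -/t => ty.
have -> : t = (D%:R - 1) * (i * t) by rewrite mulrA Di mul1r.
by rewrite ler_wpM2l // ltW.
Qed.

Lemma num_parts_bounds : 0 < ((num_parts R D n)%:~R : R) <= 2 * k * y.
Proof.
have k0 : 0 < k := lt_le_trans ltr01 kD_ge1.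
have Nk : N / k = k * y.
  by rewrite -kD_sqr_branching mulrAC mulfK ?gt_eqF // mulrC.
have ky : 1 <= k * y by rewrite mulr_ege1 ?kD_ge1 ?branching_ge1.
have := ceil_ge (N / k); have := ceilB1_lt (N / k).
by rewrite -/k -/(num_parts R D n) intrB Nk; lra.
Qed.

Lemma pD_bounds : 0 < pD R D n <= 1.
Proof.
have k0 : 0 < k := lt_le_trans ltr01 kD_ge1.
have /andP[Z0 _] := num_parts_bounds.
have t0 : 0 < t by have := ln_ge_half; lra.
by rewrite /pD lt_min ge_min lexx ltr01 /= divr_gt0 // mulr_gt0.
Qed.

(** If p = 1, this is [ln_le_branching]. Otherwise p is k t divided by a number of parts that is at
    most 2 k y, so t <= 2 y p. *)
Lemma ln_le_pD : t <= (D%:R + 1) * y * pD R D n.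
Proof.
have k0 : 0 < k := lt_le_trans ltr01 kD_ge1.
have y1 := branching_ge1; have /andP[Z0 Z2] := num_parts_bounds.
have t2 := ln_ge_half; have D2 : 2 <= D%:R :> R by rewrite ler_nat.
have t0 : 0 < t by lra.
rewrite /pD /Num.min; case: ifP => _.
  by rewrite mulr1; have := ln_le_branching; nra.
rewrite -/k -/t mulrA ler_pdivlMr // [k * t]mulrC mulrCA ler_pM2l //.
apply: le_trans Z2 _; have y0 : 0 < y := lt_le_trans ltr01 y1.
by have := mulr_gt0 D_gt0 (mulr_gt0 k0 y0); lra.
Qed.

(** One factor [y] for each level except the last. *)
Lemma kD_even : ~~ odd D -> k = y ^+ (D./2).-1.
Proof.
move=> oD; rewrite kD_powRE -powR_mulrn ?powR_ge0 // -powRrM -/i.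
congr (_ `^ _); have hD : (D = ((D./2).-1).*2 + 2)%N by lia.
have := Di; rewrite {1}hD natrD -muln2 natrM; nra.
Qed.

(** The square root accounts for the last level, which opens only half of a subdivided edge. *)
Lemma kD_odd : odd D -> k = y ^+ (D./2).-1 * Num.sqrt y.
Proof.
move=> oD; rewrite kD_powRE -powR_mulrn ?powR_ge0 // -powR12_sqrt ?powR_ge0 //.
rewrite -!powRrM -/i -powRD ?N_neq0 ?implybT //.
congr (_ `^ _); have hD : (D = ((D./2).-1).*2 + 3)%N by lia.
have := Di; rewrite {1}hD natrD -muln2 natrM; nra.
Qed.

(** The count is n^2 pairs of endpoints, n upward phases and one downward phase, and h levels with
    n^2 windows each. It is at most n^7, whence the shift by 7. *)
Lemma union_bound_le (c : R) (h : nat) : (h <= n)%N ->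
  (n * n * (n.+1 * (h * n * n)))%:R * N `^ (- (c + 7)) <= N `^ (- c).
Proof.
move=> hn; have N0 : 0 < N := lt_le_trans ltr01 N_ge1.
have -> : N `^ (- c) = N ^+ 7 * N `^ (- (c + 7)).
  by rewrite -powR_mulrn ?ltW // -powRD ?N_neq0 ?implybT //; congr (_ `^ _); lra.
rewrite ler_wpM2r ?powR_ge0 // -natrX ler_nat.
have n1 : (n.+1 <= n * n)%N by nia.
have -> : (n ^ 7 = n * n * (n * n * (n * n * n)))%N by rewrite !expnS expn0; lia.
by rewrite leq_mul2l leq_mul ?orbT // -!mulnA leq_mul2r hn orbT.
Qed.

(** Each of the D/2 levels costs one factor in the bracket; 12 is the 6 of [cost_le] times a 2 lost
    at the last level. *)
Definition dilation_const (c : R) : R :=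
  12 * ((c + 7) * (D%:R + 1) + 3) ^+ D./2.

(** Both parities at once: [th] is the success rate of the last level and [g] its share of [k]. They
    are 1 and 1 for even D, and the square roots of p and y for odd D. *)
Lemma exists_trials (c th g : R) :
  1 < c -> 0 < th <= 1 -> 1 <= g -> k = y ^+ (D./2).-1 * g ->
  1 <= 2 * (D%:R + 1) * g * th ->
  exists M : nat -> nat,
    [/\ forall i, (i.+1 < D./2)%N ->
           (1 - pD R D n) ^+ M i <= N `^ (- (c + 7)),
         (1 - th) ^+ M (D./2).-1 <= N `^ (- (c + 7)) &
         ((cost M D./2).*2 + (D./2).*2.+1)%:R <= dilation_const c * (k * t)].
Proof.
move=> c1 th01 g1 kE th_g; set h := D./2.
have h0 : (0 < h)%N by rewrite half_gt0.
have pb := pD_bounds; have tp := ln_le_pD; have y1 := branching_ge1.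
have t2 := ln_ge_half; have t0 : 0 < t by lra.
have D1 : 1 <= D%:R :> R by rewrite ler1n ltnW.
have [/andP[p0 _] /andP[th0 _]] := (pb, th01).
(* Enough trials at rate [x] for [fail_pow_le] with exponent [c + 7]. *)
pose trials x := (Num.trunc ((c + 7) * t / x)).+1.
have trials_ge x : (c + 7) * t / x <= (trials x)%:R by rewrite ltW ?truncnS_gt.
have trials_le x : 0 < x -> (trials x + 2)%:R <= (c + 7) * (t / x) + 3.
  move=> x0; have : 0 <= (c + 7) * t / x by rewrite divr_ge0 ?mulr_ge0 ?ltW //; lra.
  by move=> /truncn_itv/andP[+ _]; rewrite /trials natrD -natr1 mulrA; lra.
exists (fun i => if (i.+1 < h)%N then trials (pD R D n) else trials th); split.
- by move=> j ->; apply: fail_pow_le => //; apply: leq_trans n_gtD.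
- by rewrite prednK // ltnn; apply: fail_pow_le => //; apply: leq_trans n_gtD.
set A : R := (c + 7) * (D%:R + 1) + 3.
have aA : (trials (pD R D n) + 2)%:R <= A * y.
  apply: le_trans (trials_le _ p0) _.
  have : t / pD R D n <= (D%:R + 1) * y by rewrite ler_pdivrMr.
  rewrite -(@ler_pM2l _ (c + 7)); last by lra.
  by rewrite /A; lra.
have bA : (trials th + 2)%:R <= 2 * A * g * t.
  apply: le_trans (trials_le _ th0) _.
  have : t / th <= 2 * (D%:R + 1) * g * t.
    by rewrite ler_pdivrMr // mulrAC -[leLHS]mul1r ler_pM2r.
  rewrite -(@ler_pM2l _ (c + 7)); last by lra.
  move=> bt; apply: le_trans (lerD bt (lexx 3)) _.
  (* This absorbs the additive 3 into the product. *)
  have gt : 2^-1 <= g * t by nra.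
  by rewrite /A; lra.
set M := fun i => _; set a := trials _ in aA; set b := trials _ in bA.
have cM : ((cost M h).*2 + h.*2.+1 <= 6 * ((a + 2) ^ h.-1 * (b + 2)))%N.
  by apply: cost_le => // [j jh|]; rewrite /M ?jh // prednK // ltnn.
apply: (@le_trans _ _ (6 * ((A * y) ^+ h.-1 * (2 * A * g * t)))).
  apply: (@le_trans _ _ (6 * ((a + 2) ^ h.-1 * (b + 2)))%:R).
    by rewrite ler_nat.
  rewrite !natrM natrX ler_pM2l //.
  have Ay : 0 <= A * y := le_trans (ler0n _ _) aA.
  by apply: ler_pM => //; rewrite ?exprn_ge0 // lerXn2r ?nnegrE.
rewrite kE /dilation_const -/h -/A exprMn -[in X in _ <= X](prednK h0) exprS.
lra.
Qed.

End Rates.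

(** * Distances, routes inside a part and shortest-path parents *)

Section Graph.
Variables (R : realType) (V : finType) (e : rel V).
Implicit Types (x y s t b : V) (k : nat).

Lemma connected_route (S : {set V}) s t : s \in S -> connect (induced e S) s t ->
  exists um : (nat -> V) * nat,
    [/\ forall a, um.1 a \in S, (um.2 < #|V|)%N,
        forall a, (a < um.2)%N -> e (um.1 a) (um.1 a.+1),
        um.1 0 = s & um.1 um.2 = t].
Proof.
move=> sS /connectP[p0 /shortenP[p sp up _] ->].
(* The default value is the endpoint, so that positions past the end still lie in [S]. Simplicity of
   the path bounds its length. *)
exists (nth (last s p) (s :: p), size p) => /=; split => //.
- move=> a; have [ap|pa] := ltnP a (size p).+1; last first.
    rewrite nth_default //; case: (lastP p) sp => [//|p' y].
    by rewrite last_rcons rcons_path => /andP[_ /and3P[]].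
  case: a ap => [//|a ap]; have := pathP (last s p) sp a ap.
  by case/and3P.
- by rewrite -[(size p).+1]/(size (s :: p)) -(card_uniqP up) max_card.
- by move=> a ap; have /and3P[] := pathP (last s p) sp a ap.
- by rewrite -last_nth.
Qed.

Lemma dist_le_near k x y : near e k x y -> (dist R e x y <= k%:R%:E)%E.
Proof.
move=> [p [xp py pk]]; apply: (@le_trans _ _ (size p)%:R%:E).
  by apply: ereal_inf_lbound; exists p.
by rewrite lee_fin ler_nat.
Qed.

(** Lengths are integers: if every walk is longer than [k], the infimum is at least [k.+1]. *)
Lemma near_dist_le k x y : (dist R e x y <= k%:R%:E)%E -> near e k x y.
Proof.
move=> dk; apply: contrapT => nk; have : (k.+1%:R%:E <= dist R e x y)%E.
  apply: le_ereal_inf_tmp => _ [p [xp py ->]]; rewrite lee_fin ler_nat ltnNge.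
  by apply/negP => pk; apply: nk; exists p.
by move/le_trans => /(_ _ dk); rewrite lee_fin ler_nat ltnn.
Qed.

Lemma diam_le_near (A : {set V}) k : {in A &, forall x y, near e k x y} ->
  (diam R e A <= k%:R%:E)%E.
Proof.
by move=> nk; apply: ge_ereal_sup => _ [x [y [xA yA ->]]]; exact/dist_le_near/nk.
Qed.

Lemma near_diam k : diam R e [set: V]%SET = k%:R%:E -> forall x y, near e k x y.
Proof.
move=> ek x y; apply: near_dist_le; rewrite -ek; apply: ereal_sup_ubound.
by exists x, y; rewrite !finset.in_setT.
Qed.

Lemma diam_lt_card k : diam R e [set: V]%SET = k%:R%:E -> (k < #|V|)%N.
Proof.
move=> ek; have nk := near_diam ek; rewrite ltnNge; apply/negP => Vk.
have : (diam R e [set: V]%SET <= (#|V|.-1)%:R%:E)%E.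
  apply: diam_le_near => x y _ _; have [p [xp py _]] := nk x y.
  case/shortenP: xp py => p' xp' up' _ <-; exists p'; split => //.
  rewrite -ltnS prednK -?[(size p').+1]/(size (x :: p')) -?(card_uniqP up') ?max_card //.
  by apply/card_gt0P; exists x.
rewrite ek lee_fin ler_nat => kV.
have V0 : #|V| = 0%N by lia.
(* Without vertices the supremum is over the empty set, hence below every real, and cannot equal
   [k]. *)
have : (diam R e [set: V]%SET <= (-1)%:E)%E.
  apply: ge_ereal_sup => z [x _].
  by have := max_card (pred1 x); rewrite V0 card1.
by rewrite ek lee_fin leNgt (lt_le_trans (ltrN10 _)).
Qed.

(** The parent is the second vertex of a shortest walk to [b], or [x] itself when [x = b]. Any bound
    on the distance is at least the length of that walk, so it drops by one. *)
Lemma exists_parent k : (forall x y, near e k x y) ->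
  exists par : V -> V -> V, (forall b x, x = par b x \/ e x (par b x)) /\
    (forall b x l, near e l x b -> near e l.-1 (par b x) b).
Proof.
move=> nk.
have /choice[f fP] (bx : V * V) : exists y, (bx.2 = y \/ e bx.2 y) /\
    (forall l, near e l bx.2 bx.1 -> near e l.-1 y bx.1).
  case: bx => b x /=; pose P l := `[< near e l x b >].
  have exP : exists l, P l by exists k; apply/asboolP.
  have [l /asboolP[p [xp pb pl]] lmin] := ex_minnP exP.
  have lmin' i : near e i x b -> (l <= i)%N by move=> ni; apply/lmin/asboolP.
  case: p xp pb pl => [|y p] /= xp pb pl.
    exists x; split; first by left.
    by move=> i _; rewrite -pb; apply: near_le (near_refl _ _).
  case/andP: xp => xy yp; exists y; split; first by right.
  by move=> i /lmin' li; exists p; split => //; lia.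
exists (fun b x => f (b, x)); split=> [b x|b x l].
  by have [] := fP (b, x).
by have [_] := fP (b, x); apply.
Qed.

End Graph.

(** * Climbing from both ends, for an abstract assignment of coins to edges *)

(* [full r x y] are the coins by which x opens the edge xy in repetition r, and
   [half r x y] those by which it opens its own half of that edge.  The vertex
   after x on the route to b is [par b x]; [mid b x] is the far end of the middle
   edge, which degenerates to x itself when D is even. *)
Section Shortcut.
Variables (R : realType) (V I : finType) (e : rel V) (S : {set V}).
Variables (H : {ffun I -> bool} -> rel V) (rk : I -> nat).
Variables (full half : nat -> V -> V -> {set I}) (h D : nat).
Variables (par mid : V -> V -> V).
Variables (q eps th1 th2 : R) (M : nat -> nat).
Implicit Types (w : {ffun I -> bool}) (x y b : V) (r i a j : nat).

Hypothesis h_gt0 : (0 < h)%N.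
Hypothesis esym : symmetric e.
Hypothesis Hsym : forall w, symmetric (H w).
Hypothesis Hfree : forall w x y, x \in S -> e x y -> H w x y.
Hypothesis Hfull : forall w r x y, (r < h.*2)%N ->
  [forall c in full r x y, w c] -> e x y -> H w x y.
Hypothesis Hhalf : forall w r r' b x, (r < h.*2)%N -> (r' < h.*2)%N ->
  [forall c in half r x (mid b x), w c] ->
  [forall c in half r' (mid b x) x, w c] -> mid b x = x \/ H w (mid b x) x.
Hypothesis full_rk : forall r x y c, (r < h.*2)%N -> c \in full r x y -> rk c = r.
Hypothesis half_rk : forall r x y c, (r < h.*2)%N -> c \in half r x y -> rk c = r.
Hypothesis full_disjoint : forall r x x' y y', x != x' ->
  [disjoint full r x y & full r x' y'].
Hypothesis half_disjoint : forall r x x' y y', x != x' ->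
  [disjoint half r x y & half r x' y'].
Hypothesis par_step : forall b x, x = par b x \/ e x (par b x).
Hypothesis par_near : forall b x k, near e k x b -> near e k.-1 (par b x) b.
Hypothesis e_near : forall x y, near e D x y.
Hypothesis mid_near : forall b x, near e D x b ->
  near e h (mid b (iter h (par b) x)) b.

(** The index is shifted because the first edge of a route is free: level [i] tries to leave the
    vertex at height [i.+1]. *)
Definition labels (v : nat -> nat -> V) i a : V := v a i.+1.

(* A route that has arrived stays put; its idle steps also consult coins, which
   only makes open positions rarer. *)
Definition levels (r0 : nat) (v : nat -> nat -> V) (fin : nat -> V) i a : {set I} :=
  if (i.+1 < h)%N then full (r0 + i) (v a i.+1) (v a i.+2)
  else half (r0 + i) (v a i.+1) (fin a).

Lemma levels_rk r0 v fin i a c : (r0 <= h)%N -> (i < h)%N ->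
  c \in levels r0 v fin i a -> rk c = (r0 + i)%N.
Proof.
by move=> r0h ih; rewrite /levels; case: ifP => _; [apply: full_rk|apply: half_rk]; lia.
Qed.

Lemma levels_disjoint r0 v fin i a a' : labels v i a != labels v i a' ->
  [disjoint levels r0 v fin i a & levels r0 v fin i a'].
Proof.
by rewrite /levels; case: ifP => _ ?; [apply: full_disjoint|apply: half_disjoint].
Qed.

Section Route.
Variables (w : {ffun I -> bool}) (r0 m : nat) (u : nat -> V).
Variables (v : nat -> nat -> V) (fin : nat -> V).
Hypothesis r0h : (r0 <= h)%N.
Hypothesis uS : forall a, u a \in S.
Hypothesis u_step : forall a, (a < m)%N -> near (H w) 1 (u a) (u a.+1).
Hypothesis v0 : forall a, v a 0 = u a.
Hypothesis v_step : forall a i, v a i = v a i.+1 \/ e (v a i) (v a i.+1).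

Let o i a := opened (levels r0 v fin) i a w.

(** The first edge leaves a vertex of [S], so [k] edges need only [k.-1] open levels. *)
Lemma near_climb k a : (k <= h)%N -> o k.-1 a -> near (H w) k (u a) (v a k).
Proof.
move=> kh /openedP ok; rewrite -v0; apply: near_relay => i ik.
case: (v_step a i) => [|ee]; [by left|right].
case: i => [|i] in ik ee *; first by apply: Hfree ee; rewrite v0.
have /ok : (i < k.-1)%N by lia.
rewrite /success /levels (leq_trans ik kh) => fullw.
by apply: Hfull fullw ee; rewrite -addnn; lia.
Qed.

(** Induction on the level. Before the next position open at [i.+1], every position open at [i]
    fails its trial, so without clogging these carry at most [M i] labels. *)
Lemma near_first_open i j : (m < #|V|)%N ->
  ~ (exists x : 'I_h * 'I_#|V| * 'I_#|V|,
      clogged (labels v) (levels r0 v fin) M x.1.1 x.1.2 x.2 w) ->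
  (i <= h)%N -> (j <= m)%N ->
  near (H w) (cost M i) (u j) (u (first_from (o i) m j)).
Proof.
move=> mV unclogged; elim: i j => [|i IH] j ih jm.
  have := @first_from_min (o 0) m j j (leqnn j) isT.
  by rewrite leq_eqVlt ltnNge first_from_ge orbF => /eqP->; exact: near_refl.
have oS a : o i.+1 a = o i a && success (levels r0 v fin) i a w by exact: openedS.
apply: (near_first_from_step (o := o i) (tau := labels v i)) => //.
- by move=> a; rewrite oS => /andP[].
- move=> a b oa ob Eab; rewrite -addnn.
  have nb : near (H w) i.+1 (u b) (v b i.+1) by exact: near_climb.
  apply: near_trans (near_sym (Hsym w) nb); rewrite -[v b _]Eab.
  exact: near_climb.
- by move=> a am; apply: IH => //; exact: ltnW.
move=> ts uts its; rewrite leqNgt; apply/negP => Mts; apply: unclogged.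
have gV : (first_from (o i.+1) m j < #|V|)%N by apply: leq_ltn_trans mV; exact: first_from_le.
exists (Ordinal ih, Ordinal (leq_ltn_trans jm mV), Ordinal gV) => /=; split.
  by exists ts; split => //; exact: ltnW.
by move=> a ajg oa; have := before_first_from ajg; rewrite oS (oa : o i a).
Qed.

End Route.

Hypothesis q01 : 0 <= q <= 1.
Hypothesis eps_ge0 : 0 <= eps.
Hypothesis th1_01 : 0 <= th1 <= 1.
Hypothesis th2_01 : 0 <= th2 <= 1.
Hypothesis th1_full : forall r x y, th1 <= q ^+ #|full r x y|.
Hypothesis th2_half : forall r x y, th2 <= q ^+ #|half r x y|.
Hypothesis M_full : forall i, (i.+1 < h)%N -> (1 - th1) ^+ M i <= eps.
Hypothesis M_half : (1 - th2) ^+ M h.-1 <= eps.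

Section Pair.
Variables (u : nat -> V) (m : nat).
Hypothesis uS : forall a, u a \in S.
Hypothesis mV : (m < #|V|)%N.
Hypothesis u_step : forall w a, (a < m)%N -> H w (u a) (u a.+1).

Definition up b a i : V := iter i (par b) (u a).

(** Upward climbs use the repetitions below [h] and downward ones those from [h] on, so [meet] does
    not depend on the downward coins. *)
Definition up_levels b := levels 0 (up b) (fun a => mid b (up b a h)).

Definition up_open w b : nat :=
  first_from (fun a => opened (up_levels b) h a w) m 0.

Definition meet w b : V := up b (up_open w b) h.

(** The path is traversed backwards. Each position is its own target b, and its route heads for the
    middle vertex that the upward climb towards that b selects. *)
Definition down (z : V -> V) a i : V :=
  iter i (par (mid (u (m - a)) (z (u (m - a))))) (u (m - a)).

Definition down_levels z := levels h (down z) (fun a => z (u (m - a))).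

(** All upward targets are included, as the one where the downward walk stops is not known in
    advance. *)
Definition congested w : Prop :=
  (exists b, exists x : 'I_h * 'I_#|V| * 'I_#|V|,
     clogged (labels (up b)) (up_levels b) M x.1.1 x.1.2 x.2 w) \/
  (exists x : 'I_h * 'I_#|V| * 'I_#|V|,
     clogged (labels (down (meet w))) (down_levels (meet w)) M x.1.1 x.1.2 x.2 w).

(** Two walks along the path, two climbs of [h] edges, and one step across the middle edge. *)
Lemma near_ends w : ~ congested w ->
  near (H w) ((cost M h).*2 + h.*2.+1) (u 0) (u m).
Proof.
have one_leg c : (c <= c.*2 + h.*2.+1)%N by rewrite -addnn -addnA leq_addr.
have two_legs c : (c + (h + (1 + (h + c))) <= c.*2 + h.*2.+1)%N.
  by rewrite -!addnn; lia.
have pred_lt r : (r < h.-1)%N -> (r < h)%N by lia.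
have pred_sub a : (a < m)%N -> (m - a.+1 < m)%N by lia.
move=> ncong.
have iter_step b x i : iter i (par b) x = iter i.+1 (par b) x \/
    e (iter i (par b) x) (iter i.+1 (par b) x) by exact: par_step.
have up_walk b : near (H w) (cost M h) (u 0) (u (up_open w b)).
  apply: (@near_first_open w 0 m u (up b) (fun a => mid b (up b a h))) => //.
  - by move=> a am; exact/near_edge/u_step.
  - by move=> a i; exact: iter_step.
  - by move=> cl; apply: ncong; left; exists b.
pose u' a := u (m - a)%N.
set j := first_from (fun a => opened (down_levels (meet w)) h a w) m 0.
have down_walk : near (H w) (cost M h) (u' 0) (u' j).
  apply: (@near_first_open w h m u' (down (meet w)) (fun a => meet w (u (m - a)))) => //.
  - by move=> a; exact: uS.
  - move=> a am; rewrite /u'; apply/near_sym/near_edge => //.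
    by have := u_step w (pred_sub a am); rewrite -subSn // subSS.
  - by move=> a i; exact: iter_step.
  - by move=> cl; apply: ncong; right.
rewrite /u' subn0 in down_walk.
have jm : (j <= m)%N by exact: first_from_le.
(* If no downward position is open, that walk has already reached the other end; likewise for the
   upward walk below. *)
have [mj|jm'] := leqP m j.
  have Ej : j = m by apply/eqP; rewrite eqn_leq jm.
  move: down_walk; rewrite Ej subnn => /(near_sym (Hsym w)).
  by apply: near_le.
have {}down_open : opened (down_levels (meet w)) h j w.
  exact: (@first_fromP (fun a => opened (down_levels (meet w)) h a w)).
set b := u (m - j) in down_walk.
have [mk|km] := leqP m (up_open w b).
  have Ek : up_open w b = m by apply/eqP; rewrite eqn_leq first_from_le.
  by have := up_walk b; rewrite Ek; apply: near_le.
have {}up_open_b : opened (up_levels b) h (up_open w b) w.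
  exact: (@first_fromP (fun a => opened (up_levels b) h a w)).
have opened_pred K a : opened K h a w -> opened K h.-1 a w.
  by move=> /openedP op; apply/openedP => r rh; apply/op/pred_lt.
have up_climb : near (H w) h (u (up_open w b)) (meet w b).
  apply: (@near_climb w 0 u (up b) (fun a => mid b (up b a h))) => //.
    by move=> a i; exact: iter_step.
  exact: opened_pred.
have down_climb : near (H w) h b (down (meet w) j h).
  apply: (@near_climb w h (fun a => u (m - a)) (down (meet w))
    (fun a => meet w (u (m - a)))) => //.
    by move=> a i; exact: iter_step.
  exact: opened_pred.
(* The middle vertex is within [h] of [b], so [h] parent steps from [b] end exactly there. *)
have Edown : down (meet w) j h = mid b (meet w b).
  rewrite /down -/b; set z := mid b _.
  have : near e h b z by apply: near_sym => //; apply/mid_near/e_near.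
  have iter_near k x : near e k x z -> near e 0 (iter k (par z) x) z.
    elim: k x => [//|k IH] x /par_near /IH; by rewrite -iterSr.
  by case/iter_near => -[|? ?] [].
(* The last level of each climb has opened its own half of the middle edge. *)
have join : near (H w) 1 (meet w b) (down (meet w) j h).
  have hh : (h.-1 < h)%N by rewrite prednK.
  have r1 : (0 + h.-1 < h.*2)%N by rewrite -addnn ltn_addr.
  have r2 : (h + h.-1 < h.*2)%N by rewrite -addnn ltn_add2l.
  have := openedP _ _ _ _ up_open_b _ hh; have := openedP _ _ _ _ down_open _ hh.
  rewrite /success /up_levels /down_levels /levels prednK // ltnn Edown -/b.
  move=> half_down half_up.
  have [] := Hhalf r1 r2 half_up half_down.
    by rewrite -/(meet w b) => ->; apply: near_le (near_refl _ _).
  by move=> ?; apply/near_sym/near_edge.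
apply: near_le (two_legs _) (near_trans (up_walk b) (near_trans up_climb (near_trans join
  (near_trans (near_sym (Hsym w) down_climb) (near_sym (Hsym w) down_walk))))).
Qed.

Lemma clogged_levels_Pr_le (r0 : nat) v fin : (r0 <= h)%N ->
  coins_Pr q (fun w => exists x : 'I_h * 'I_#|V| * 'I_#|V|,
     clogged (labels v) (levels r0 v fin) M x.1.1 x.1.2 x.2 w)
    <= (h * #|V| * #|V|)%:R * eps.
Proof.
(* Ranks are shifted so that the levels start at 0. Truncation sends lower repetitions to rank 0,
   but [levels] contains no such coins. *)
move=> r0h; apply: (@clogged_Pr_le _ _ _ _ _ q eps (fun c => rk c - r0)%N
  (fun i => if (i.+1 < h)%N then th1 else th2)) => //.
- by move=> i a c ih /levels_rk -> //; rewrite addKn.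
- by move=> i a b _; apply: levels_disjoint.
- by move=> i _; case: ifP.
- by move=> i a _; rewrite /levels; case: ifP.
- move=> i ih; case: ifP => [|hi]; first exact: M_full.
  have -> // : i = h.-1.
  by apply/eqP; rewrite -eqSS prednK // eqn_leq ih leqNgt hi.
Qed.

Lemma congested_Pr_le :
  coins_Pr q (congested) <= (#|V|.+1 * (h * #|V| * #|V|))%:R * eps.
Proof.
rewrite mulSn addnC natrD mulrDl; apply: coins_Pr_or_le => //.
  rewrite natrM -mulrA; apply: coins_Pr_exists_le => // b.
  exact: clogged_levels_Pr_le.
pose B := [set c | h <= rk c]%N%SET.
apply: (coins_Pr_resample_le q01 (B := B)) => w1.
apply: le_trans (clogged_levels_Pr_le (down (meet w1))
  (fun a => meet w1 (u (m - a))) (leqnn h)).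
apply: coins_Pr_mono => // w2.
have -> : meet (resample B w1 w2) = meet w1.
  apply/funext => b; rewrite /meet /up_open; congr (up b (first_from _ m 0) h).
  apply/funext => a; apply: eq_in_all => r; rewrite mem_iota => /andP[_ rh].
  apply: success_resample_out; apply/pred0P => c /=; apply/negP => /andP[cK].
  by rewrite finset.inE (levels_rk _ _ cK) // leqNgt rh.
rewrite -/(down_levels (meet w1)); case=> -[[i j] k] /= [[ts [uts Mts its]] fail].
have sB r a : (r < h)%N -> success (down_levels (meet w1)) r a (resample B w1 w2) =
    success (down_levels (meet w1)) r a w2.
  move=> rh; apply: success_resample_in; apply/fintype.subsetP => c cK.
  by rewrite finset.inE (levels_rk _ _ cK) // leq_addr.
have oB a : opened (down_levels (meet w1)) i a (resample B w1 w2) =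
    opened (down_levels (meet w1)) i a w2.
  apply: eq_in_all => r; rewrite mem_iota => /andP[_ ri]; apply: sB.
  exact: ltn_trans ri (ltn_ord i).
exists (i, j, k) => /=; split.
  by exists ts; split => // a /its; rewrite oB.
by move=> a /fail; rewrite oB sB.
Qed.

End Pair.

(** The path joining each pair is chosen before the coins are drawn; then a union bound over pairs
    applies. *)
Lemma shortcut_near_Pr_ge : induces_connected e S ->
  1 - (#|V| * #|V| * (#|V|.+1 * (h * #|V| * #|V|)))%:R * eps <=
  coins_Pr q (fun w => {in S &, forall s t,
    near (H w) ((cost M h).*2 + h.*2.+1) s t}).
Proof.
move=> Sconn; have /choice[f fP] (st : V * V) : exists um : (nat -> V) * nat,
    st.1 \in S -> st.2 \in S ->
    [/\ forall a, um.1 a \in S, (um.2 < #|V|)%N,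
        forall a, (a < um.2)%N -> e (um.1 a) (um.1 a.+1),
        um.1 0 = st.1 & um.1 um.2 = st.2].
  case: st => s t /=; have [sS|] := boolP (s \in S); last first.
    by exists (fun=> s, 0%N).
  have [tS|] := boolP (t \in S); last by exists (fun=> s, 0%N).
  by have [um umP] := connected_route sS (Sconn s t sS tS); exists um.
pose E (st : V * V) w :=
  [/\ st.1 \in S, st.2 \in S & congested (f st).1 (f st).2 w].
apply: le_trans (coins_Pr_compl_ge q01 (E := fun w => exists st, E st w) _).
  rewrite lerD2l lerN2 natrM -card_prod -mulrA.
  apply: coins_Pr_exists_le => // st.
  have [/andP[sS tS]|nS] := boolP ((st.1 \in S) && (st.2 \in S)).
    have [uS mV u_step _ _] := fP st sS tS.
    apply: le_trans (_ : coins_Pr q (congested (f st).1 (f st).2) <= _).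
      by apply: coins_Pr_mono => // w [].
    exact: congested_Pr_le.
  apply: le_trans (_ : coins_Pr q (fun=> False) <= _).
    by apply: coins_Pr_mono => // w [sS tS]; rewrite sS tS in nS.
  by rewrite coins_PrE asboolF // expect1 mulr_ge0.
move=> w nE s t sS tS; have [uS mV u_step us ut] := fP (s, t) sS tS.
suff : near (H w) ((cost M h).*2 + h.*2.+1)
    ((f (s, t)).1 0) ((f (s, t)).1 (f (s, t)).2) by rewrite us ut.
apply: near_ends => //.
  by move=> w' a am; apply: Hfree => //; apply: u_step.
by move=> cong; apply: nE; exists (s, t).
Qed.

Lemma shortcut_diam_Pr_ge (a X : R) : induces_connected e S ->
  (#|V| * #|V| * (#|V|.+1 * (h * #|V| * #|V|)))%:R * eps <= a ->
  ((cost M h).*2 + h.*2.+1)%:R <= X ->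
  1 - a <= coins_Pr q (fun w => (diam R (H w) S <= X%:E)%E).
Proof.
move=> Sconn epsa costX; rewrite (le_trans _ (le_trans (shortcut_near_Pr_ge Sconn) _)) //.
  by rewrite lerD2l lerN2.
apply: coins_Pr_mono => // w near_w.
by apply: le_trans (diam_le_near R near_w) _; rewrite lee_fin.
Qed.

End Shortcut.

(** * The even and odd constructions as instances *)

Section Constructions.
Variables (R : realType) (D : nat) (c : R).
Variables (V : finType) (e : rel V) (S : {set V}) (l : nat) (j : 'I_l).
Hypotheses (D_gt1 : (1 < D)%N) (c_gt1 : 1 < c).
Hypotheses (esym : symmetric e) (eD : diam R e [set: V]%SET = D%:R%:E).
Hypothesis Sconn : induces_connected e S.

Let D_gt0 : (0 < D)%N. Proof. exact: ltnW. Qed.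

(** Reduction modulo [D] makes this total; it fixes the indices below [(D./2).*2], which number at
    most [D]. *)
Let repetition r : 'I_D := Ordinal (ltn_pmod r D_gt0).

Let repetitionE r : (r < (D./2).*2)%N -> repetition r = r :> nat.
Proof. by move=> rD; rewrite /= modn_small // (leq_trans rD) //; lia. Qed.

Let V_gtD : (D < #|V|)%N. Proof. exact: diam_lt_card eD. Qed.

Let half_le : (D./2 <= #|V|)%N.
Proof. by apply: leq_trans (ltnW V_gtD); lia. Qed.

Lemma centralized_sym (m : nat) (W : finType) (f : rel W) (A : {set W})
    (w : {ffun coin l m W -> bool}) : symmetric f -> symmetric (centralized f A w j).
Proof.
move=> fsym a b; rewrite /centralized fsym [(a \in A) || _]orbC.
by congr (_ || _); rewrite orbC.
Qed.

Lemma augmented_sym (H : rel V) : symmetric H -> symmetric (augmented e S H).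
Proof. by move=> Hsym a b; rewrite /augmented /induced Hsym esym andbCA. Qed.

Lemma near_iter_parent (par : V -> V -> V) b x i k :
  (forall b x l, near e l x b -> near e l.-1 (par b x) b) ->
  near e k x b -> near e (k - i) (iter i (par b) x) b.
Proof.
by move=> pn nx; elim: i => [|i /pn]; rewrite ?subn0 //= subnS.
Qed.

(** The two climbs of D/2 steps meet at a vertex, so [mid] is trivial and the last level consults no
    coin. *)
Lemma even_shortcut : ~~ odd D ->
  1 - #|V|%:R `^ (- c) <= coins_Pr (pD R D #|V|)
    (fun w : {ffun coin l D V -> bool} =>
       (diam R (augmented e S (centralized e S w j)) S
        <= (dilation_const D c * (kD R D #|V| * ln #|V|%:R))%:E)%E).
Proof.
move=> oD; have Dh : (D - D./2 <= D./2)%N by lia.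
have [par [par_step par_near]] := exists_parent (near_diam eD).
have pb := pD_bounds R D_gt1 V_gtD; have /andP[p0 p1] := pb.
have D0 : 1 <= D%:R :> R by rewrite ler1n.
have [||||M [M1 M2 M3]] := @exists_trials R D #|V| D_gt1 V_gtD c 1 1 c_gt1.
- by rewrite ltr01 lexx.
- by [].
- by rewrite mulr1 kD_even.
- by lra.
apply: (shortcut_diam_Pr_ge (H := fun w => augmented e S (centralized e S w j))
  (rk := fun x => x.1.2) (full := fun r x y => [set (j, repetition r, (x, y))]%SET)
  (half := fun _ _ _ => finset.set0) (h := D./2) (D := D) (par := par)
  (mid := fun _ x => x) (eps := #|V|%:R `^ (- (c + 7)))
  (th1 := pD R D #|V|) (th2 := 1) (M := M)) => //.
- by rewrite half_gt0.
- by move=> w; apply/augmented_sym/centralized_sym.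
- by move=> w x y xS xy; rewrite /augmented /centralized xy xS orbT.
- move=> w r x y _ /forall_inP/(_ _ (set11 _)) wc xy.
  rewrite /augmented /centralized /samples xy /=; have [//|xS] := boolP (x \in S).
    by rewrite orbT.
  by apply/orP; right; apply/orP; right; apply/orP; left; apply/existsP; exists (repetition r).
- by move=> w r r' b x _ _ _ _; left.
- by move=> r x y d rh; rewrite finset.in_set1 => /eqP -> /=; apply: repetitionE.
- by move=> r x y d _; rewrite finset.in_set0.
- move=> r x x' y y' xx'; rewrite disjoints1 finset.in_set1.
  by apply: contraNN xx' => /eqP[->].
- by move=> r x x' y y' _; rewrite -setI_eq0 finset.set0I.
- exact: near_diam eD.
- by move=> b x /(near_iter_parent D./2 par_near); apply: near_le.
- by rewrite ltW.
- by rewrite ltW.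
- by rewrite ler01 lexx.
- by move=> r x y; rewrite cards1 expr1.
- by move=> r x y; rewrite cards0 expr0.
- exact: (union_bound_le D_gt1 V_gtD).
Qed.

Let subdividing (x y : V) : option (edge e) := insub [set x; y]%SET.

Let subdividingP x y z : subdividing x y = Some z -> val z = [set x; y]%SET.
Proof. by rewrite /subdividing; case: insubP => // u _ <- [->]. Qed.

Let subdividing_edge x y : e x y -> exists z, subdividing x y = Some z.
Proof.
move=> xy; rewrite /subdividing; case: insubP => [z _ _|]; first by exists z.
by case/negP; apply/imsetP; exists (x, y); rewrite ?finset.inE.
Qed.

Let subdividing_sym x y : subdividing x y = subdividing y x.
Proof. by rewrite /subdividing finset.setUC. Qed.

Let half_coins r x y : {set coin l D (V + edge e)%type} :=
  if subdividing x y is Some z then [set (j, repetition r, (inl x, inr z))]%SET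
  else finset.set0.

Let full_coins r x y : {set coin l D (V + edge e)%type} :=
  if subdividing x y is Some z then
    [set (j, repetition r, (inl x, inr z)); (j, repetition r, (inr z, inl y))]%SET
  else finset.set0.

Let half_coins_disjoint r x x' y y' : x != x' ->
  [disjoint half_coins r x y & half_coins r x' y'].
Proof.
move=> xx'; apply/pred0P => d /=; apply: contraNF xx'; rewrite /half_coins.
case: subdividing => [z|]; last by rewrite finset.in_set0.
case: subdividing => [z'|]; last by rewrite finset.in_set0 andbF.
by rewrite !finset.in_set1 => /andP[/eqP-> /eqP[->]].
Qed.

(** The first coin names [x]. The second names [y] and the edge, and these together determine
    [x]. *)
Let full_coins_disjoint r x x' y y' : x != x' ->
  [disjoint full_coins r x y & full_coins r x' y'].
Proof.
move=> xx'; apply/pred0P => d /=; apply: contraNF xx'; rewrite /full_coins.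
case E: subdividing => [z|]; last by rewrite finset.in_set0.
case E': subdividing => [z'|]; last by rewrite finset.in_set0 andbF.
rewrite !finset.in_set2 => /andP[/orP[]/eqP-> /orP[]/eqP[]] //; first by move=> ->.
move=> zz' yy'; have := subdividingP E; rewrite zz' (subdividingP E') -yy'.
move=> xy; have : x' \in [set x; y]%SET by rewrite -xy finset.set21.
rewrite finset.in_set2 => /orP[/eqP->//|/eqP x'y].
have : x \in [set x'; y]%SET by rewrite xy finset.set21.
by rewrite finset.in_set2 x'y orbb.
Qed.

Lemma subdivision_sym : symmetric (@subdivision V e).
Proof. by case=> [u|x] [v|y]. Qed.

Lemma centralized_odd_sym (w : {ffun coin l D (V + edge e)%type -> bool}) :
  symmetric (centralized_odd S w j).
Proof.
move=> u v; rewrite /centralized_odd esym [(u \in S) || _]orbC; congr (_ || _).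
apply: eq_existsb => x; rewrite finset.setUC; congr [&& _, _ & _].
by rewrite andbC; congr andb; apply: centralized_sym; apply: subdivision_sym.
Qed.

(** The second half-edge may be sampled from either side: by [z] when [x] opens the whole edge
    alone, by [y] when the two ends share it. *)
Lemma centralized_odd_edge (w : {ffun coin l D (V + edge e)%type -> bool}) r r' x y z :
  e x y -> subdividing x y = Some z -> w (j, r, (inl x, inr z)) ->
  (w (j, r', (inr z, inl y)) || w (j, r', (inl y, inr z))) ->
  centralized_odd S w j x y.
Proof.
move=> xy xyz wx wy; apply/orP; rewrite xy /=.
have [_|xS] := boolP (x \in S); first by left.
have [_|yS] := boolP (y \in S); first by left.
right; apply/existsP; exists z; rewrite (subdividingP xyz) eqxx /=.
have inS u : (inl u \in ([set inl a | a in S]%SET : {set (V + edge e)%type})) = (u \in S).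
  by rewrite mem_imset // => ? ? [].
have inrS : (inr z \in ([set inl a | a in S]%SET : {set (V + edge e)%type})) = false.
  by apply/imsetP => -[].
rewrite /centralized /samples !inS inrS (negbTE xS) (negbTE yS) /=.
rewrite (subdividingP xyz) finset.set21 finset.set22 /=.
apply/andP; split; first by apply/orP; left; apply/existsP; exists r.
by case/orP: wy => wy; apply/orP; [left|right]; apply/existsP; exists r'.
Qed.

(** The middle edge is the parent step taken at height [D./2]. Opening it from one end takes one
    coin of rate sqrt p, whereas a full edge takes two. *)
Lemma odd_shortcut : odd D ->
  1 - #|V|%:R `^ (- c) <= coins_Pr (Num.sqrt (pD R D #|V|))
    (fun w : {ffun coin l D (V + edge e)%type -> bool} =>
       (diam R (augmented e S (centralized_odd S w j)) S
        <= (dilation_const D c * (kD R D #|V| * ln #|V|%:R))%:E)%E).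
Proof.
move=> oD; have Dh : ((D - D./2).-1 <= D./2)%N by lia.
have [par [par_step par_near]] := exists_parent (near_diam eD).
have /andP[p0 p1] := pD_bounds R D_gt1 V_gtD.
have tp := ln_le_pD R D_gt1 V_gtD; have t2 := ln_ge_half R D_gt1 V_gtD.
have B1 := branching_ge1 R D_gt1 V_gtD.
set p := pD R D #|V| in p0 p1 tp *; set B := branching R D #|V| in B1 tp.
have sp0 : 0 < Num.sqrt p by rewrite sqrtr_gt0.
have sp1 : Num.sqrt p <= 1 by rewrite -[leRHS]sqrtr1 ler_wsqrtr.
have sB1 : 1 <= Num.sqrt B by rewrite -[leLHS]sqrtr1 ler_wsqrtr.
have sp01 : 0 <= Num.sqrt p <= 1 by rewrite sp1 ltW.
have pE : p = Num.sqrt p ^+ 2 by rewrite sqr_sqrtr // ltW.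
have BE : B = Num.sqrt B ^+ 2 by rewrite sqr_sqrtr // (le_trans ler01).
(* From ln n >= 1/2 and [ln_le_pD] the bound holds with [s * s] in place of [s]; if [s < 1] then
   [s * s <= s], and otherwise it is immediate. *)
have rate : 1 <= 2 * (D%:R + 1) * Num.sqrt B * Num.sqrt p.
  have D0 : 1 <= D%:R :> R by rewrite ler1n.
  rewrite -mulrA; set s := Num.sqrt B * Num.sqrt p.
  have s0 : 0 < s by rewrite mulr_gt0 // (lt_le_trans ltr01).
  have : 1 <= 2 * (D%:R + 1) * (s * s).
    have -> : s * s = B * p by rewrite pE BE !expr2 mulrACA.
    by lra.
  have [s1 _|s1] := leP 1 s.
    by apply: le_trans s1 _; rewrite ler_peMl ?ltW //; lra.
  have ss : s * s <= s by rewrite ger_pMl // ltW.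
  by move=> /le_trans; apply; apply: ler_wpM2l ss; lra.
have [||M [M1 M2 M3]] := @exists_trials R D #|V| D_gt1 V_gtD c
  (Num.sqrt p) (Num.sqrt B) c_gt1 _ sB1 _ rate.
- by rewrite sp0.
- exact: kD_odd.
apply: (shortcut_diam_Pr_ge (H := fun w => augmented e S (centralized_odd S w j))
  (rk := fun x => x.1.2) (full := full_coins) (half := half_coins) (h := D./2)
  (D := D) (par := par) (mid := par) (eps := #|V|%:R `^ (- (c + 7)))
  (th1 := p) (th2 := Num.sqrt p) (M := M)) => //.
- by rewrite half_gt0.
- by move=> w; apply/augmented_sym/centralized_odd_sym.
- by move=> w x y xS xy; rewrite /augmented /centralized_odd xy xS orbT.
- move=> w r x y _ + xy; have [z xyz] := subdividing_edge xy.
  rewrite /full_coins xyz => /forall_inP wz; apply/orP; right.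
  apply: (centralized_odd_edge (r := repetition r) (r' := repetition r) xy xyz);
    first by rewrite wz // finset.set21.
  by rewrite wz // finset.set22.
- move=> w r r' b x _ _; have [|xb] := par_step b x; first by left.
  rewrite /half_coins [subdividing (par b x) x]subdividing_sym.
  have [z xbz] := subdividing_edge xb; rewrite xbz.
  move=> /forall_inP/(_ _ (set11 _)) wx /forall_inP/(_ _ (set11 _)) wb; right.
  rewrite augmented_sym; last exact: centralized_odd_sym.
  apply/orP; right.
  apply: (centralized_odd_edge (r := repetition r) (r' := repetition r') xb xbz) => //.
  by rewrite wb orbT.
- move=> r x y d rh; rewrite /full_coins; case: subdividing => [z|]; last first.
    by rewrite finset.in_set0.
  by rewrite finset.in_set2 => /orP[] /eqP-> /=; apply: repetitionE.
- move=> r x y d rh; rewrite /half_coins; case: subdividing => [z|]; last first.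
    by rewrite finset.in_set0.
  by rewrite finset.in_set1 => /eqP-> /=; apply: repetitionE.
- exact: near_diam eD.
(* After [D./2] parent steps and the middle edge, at most D - D/2 - 1 = D/2 steps remain, with D/2
   rounded down. *)
- move=> b x /(near_iter_parent D./2 par_near) /par_near; exact: near_le.
- by rewrite p1 ltW.
- move=> r x y; rewrite /full_coins; case: subdividing => [z|].
    rewrite {1}pE ler_wiXn2l ?sp1 ?(ltW sp0) //.
    by rewrite finset.cards2; case: eqP.
  by rewrite cards0 expr0.
- move=> r x y; rewrite /half_coins; case: subdividing => [z|].
    by rewrite cards1 expr1.
  by rewrite cards0 expr0.
- exact: (union_bound_le D_gt1 V_gtD).
Qed.

End Constructions.

Unset Implicit Arguments.

Theorem theorem3p1 (R : realType) (D : nat) (hD : (1 < D)%N) (c : R) (hc : 1 < c) :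
  exists2 C : R, 0 < C &
    forall (V : finType) (e : rel V) (parts : {set {set V}}),
      symmetric e -> irreflexive e ->
      diam R e [set: V]%SET = (D%:R)%:E ->
      disjoint_connected_parts e parts ->
      forall j : 'I_#|large_parts R D parts|,
        1 - #|V|%:R `^ (- c) <=
        shortcut_Pr e
          (fun H : 'I_#|large_parts R D parts| -> rel V =>
             (diam R (augmented e (large_part j) (H j)) (large_part j)
              <= (C * (kD R D #|V| * ln #|V|%:R))%:E)%E).
Proof.
exists (dilation_const D c).
  by rewrite mulr_gt0 // exprn_gt0 // addr_gt0 // mulr_gt0 // addr_gt0 //; lra.
move=> V e parts esym _ eD [_ conn] j.
have Sconn : induces_connected e (large_part j).
  apply: conn; have := enum_valP j; rewrite finset.inE => /andP[jparts _].
  exact: jparts.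
rewrite /shortcut_Pr; case: ifP => oD; first exact: odd_shortcut.
by apply: even_shortcut => //; rewrite oD.
Qed.
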